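(* Let $n\ge m\ge 3$. Then $$\mu_{\rm t}(C_n\,\square\,C_m)=\begin{cases}3, & (n,m)\in\{(3,3),(4,3)\},\\ 4, & (n,m)=(4,4),\\ 0, & \text{otherwise}.\end{cases}$$
   Context: $C_n$ is the cycle on $n$ vertices and $C_n\,\square\,C_m$ is the Cartesian product (torus graph). For a graph $G$ and $X\subseteq V(G)$, vertices $u,v\in V(G)$ are $X$-visible if there exists a shortest $u,v$-path $P$ with $V(P)\cap X\subseteq\{u,v\}$. $X$ is a total mutual-visibility set if every two vertices of $V(G)$ are $X$-visible; $\mu_{\rm t}(G)$ is the maximum cardinality of a total mutual-visibility set of $G$ (the empty set is allowed, so the value may be $0$). *)

(* Defs.v *)
From mathcomp Require Import all_boot.
From mathcomp Require Import boolp.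

Set Implicit Arguments.
Unset Strict Implicit.
Unset Printing Implicit Defensive.

(* A finite graph is given by its adjacency relation on a finite type of
   vertices. *)

Section Visibility.
Variables (T : finType) (e : rel T).

(* As in path.v, the sequence of vertices is u :: p. *)
Definition is_path (u v : T) (p : seq T) : bool :=
  [&& path e u p, last u p == v & uniq (u :: p)].

Definition is_shortest_path (u v : T) (p : seq T) : Prop :=
  is_path u v p /\ forall q : seq T, is_path u v q -> size p <= size q.

Definition visible (X : {set T}) (u v : T) : Prop :=
  exists p : seq T,
    is_shortest_path u v p /\ [set w in u :: p] :&: X \subset [set u; v].

Definition total_mutual_visibility_set (X : {set T}) : Prop :=
  forall u v : T, u != v -> visible X u v.

(* In a connected graph, set0 is a total mutual-visibility set, so the value 0
   of an empty maximum only plays a role for disconnected graphs. *)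
Definition mut : nat :=
  \max_(X : {set T} | `[< total_mutual_visibility_set X >]) #|X|.

End Visibility.

(* ordS is the successor modulo n; this is a simple graph for n >= 2, and the
   usual cycle for n >= 3. *)
Definition cycle_graph (n : nat) : rel 'I_n :=
  fun i j => (j == ordS i) || (i == ordS j).

Definition cartesian_product (T1 T2 : finType) (e1 : rel T1) (e2 : rel T2) :
    rel (T1 * T2) :=
  fun x y => (x.1 == y.1) && e2 x.2 y.2 || (x.2 == y.2) && e1 x.1 y.1.

Lemma cycle_graph_sym n : symmetric (@cycle_graph n).
Proof. by move=> i j; rewrite /cycle_graph orbC. Qed.

Lemma cycle_graph_irrefl n : 1 < n -> irreflexive (@cycle_graph n).
Proof.
move=> n_gt1 i; rewrite /cycle_graph orbb; apply/eqP => /(congr1 val) /= eq_i.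
have := ltn_ord i; rewrite leq_eqVlt => /predU1P[iE | ltSi].
  by move: eq_i n_gt1; rewrite iE modnn => i0; rewrite -iE i0.
by move: eq_i; rewrite modn_small // => /eqP; rewrite -[X in X == _]addn0 -addn1 eqn_add2l.
Qed.

Lemma cartesian_product_sym (T1 T2 : finType) (e1 : rel T1) (e2 : rel T2) :
  symmetric e1 -> symmetric e2 -> symmetric (cartesian_product e1 e2).
Proof.
move=> s1 s2 x y; rewrite /cartesian_product s1 s2.
by rewrite [x.1 == _]eq_sym [x.2 == _]eq_sym.
Qed.

Lemma cartesian_product_irrefl (T1 T2 : finType) (e1 : rel T1) (e2 : rel T2) :
  irreflexive e1 -> irreflexive e2 -> irreflexive (cartesian_product e1 e2).
Proof. by move=> i1 i2 x; rewrite /cartesian_product i1 i2 !andbF. Qed.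

(* Main.v *)
Require Import Defs.
From mathcomp Require Import all_boot.
From mathcomp Require Import boolp zify.

(* If all the common neighbours of two distinct nonadjacent vertices u and v
   lie in {x, y}, then every shortest u,v-path passes through x or y, so no
   total mutual-visibility set contains both x and y.
   - If n >= 5, then (i - 1, j) and (i + 1, j) have (i, j) as only common
     neighbour; take x = y = (i, j).
   - Otherwise n <= 4, and the vertices are partitioned into as many classes as
     the claimed value, in such a way that any two vertices of a class are the
     common neighbours of some pair.
   The values 3 and 4 are attained by explicit sets, for which, from any vertex
   u <> v, one can always step closer to v while avoiding the set. *)

Set Implicit Arguments.
Unset Strict Implicit.
Unset Printing Implicit Defensive.

Section Visibility.
Variables (T : finType) (e : rel T).
Implicit Types (x y u v w : T) (X : {set T}).

(** The path through [x] bounds a shortest path by two edges; fewer are impossible for distinct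
    nonadjacent ends, so [w] is its middle vertex. *)
Lemma visible_common_neighbour X u v x :
  u != v -> ~~ e u v -> e u x -> e x v -> visible e X u v ->
  exists w, [/\ e u w, e w v & w \notin X].
Proof.
move=> uv nuv ux xv [p [[/and3P[ep /eqP lp up] minp] /subsetP sub]].
have xv_neq : x != v by apply: contraNneq nuv => <-.
have xu_neq : u != x by apply: contraNneq nuv => ->.
have szp : size p <= 2.
  apply: (minp [:: x; v]); rewrite /is_path /= ux xv eqxx /=.
  by rewrite !inE negb_or xu_neq uv xv_neq.
case: p ep lp up sub szp {minp} => [|w [|v' []]] //=.
- by move=> _ uvE; rewrite uvE eqxx in uv.
- by rewrite andbT => euw wv; rewrite -wv euw in nuv.
rewrite andbT => /andP[uw wv'] v'v; subst v'.
rewrite !inE negb_or andbT => /andP[/andP[uw_neq _] wv_neq] sub _.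
exists w; split=> //; apply/negP => wX.
have := sub w; rewrite !inE wX eqxx orbT /= => /(_ isT).
by rewrite eq_sym (negbTE uw_neq) (negbTE wv_neq).
Qed.

(** For [x = y] this keeps [x] out of every total mutual-visibility set. *)
Definition blocked x y := exists u v,
  [/\ u != v, ~~ e u v, e u x, e x v &
      forall w, e u w -> e w v -> w = x \/ w = y].

Lemma blocked_notin X x y :
  total_mutual_visibility_set e X -> blocked x y -> x \in X -> y \notin X.
Proof.
move=> visX [u [v [uv nuv ux xv common]]] xX.
have [w [uw wv wX]] := visible_common_neighbour uv nuv ux xv (visX u v uv).
by have [wx | <- //] := common w uw wv; rewrite wx xX in wX.
Qed.

(** The Lipschitz condition makes [h] a lower bound for the length of paths to [v]; greedy descent
    attains it, so the path it traces is shortest. *)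
Lemma visible_descent X v (h : T -> nat) :
  h v = 0 -> (forall x y, e x y -> h x <= (h y).+1) ->
  (forall u, u != v ->
     exists w, [/\ e u w, h w < h u & (w == v) || (w \notin X)]) ->
  forall u, visible e X u v.
Proof.
move=> hv lip step u.
have lower q w : path e w q -> last w q = v -> h w <= size q.
  elim: q w => [|z q IHq] w /= => [_ -> |/andP[wz ez] lz]; first by rewrite hv.
  by rewrite (leq_trans (lip _ _ wz)) // ltnS IHq.
have [p [ep lp hp dp Xp]] : exists p, [/\ path e u p, last u p = v,
    size p = h u, path (fun x y => h y < h x) u p &
    all (fun w => (w == v) || (w \notin X)) p].
  have [k] := ubnP (h u); elim: k u => // k IHk u; rewrite ltnS => hu.
  have [-> | /step[w [uw hw wX]]] := eqVneq u v; first by exists [::].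
  have [p [ep lp hp dp Xp]] := IHk w (leq_trans hw hu).
  exists (w :: p); split=> //=; rewrite ?uw ?hw ?wX //.
  by rewrite hp; apply/eqP; rewrite eqn_leq hw lip.
exists p; split; last first.
  apply/subsetP => w; rewrite !inE => /andP[/orP[-> // | wp] wX].
  by have := allP Xp _ wp; rewrite wX orbF => ->; rewrite orbT.
split; last by move=> q /and3P[eq /eqP lq _]; rewrite hp lower.
rewrite /is_path ep lp eqxx.
(* Strict descent of [h] rules out repeated vertices. *)
apply: (@sorted_uniq _ (fun x y => h y < h x)) => // [y x z xy yz|x].
  exact: ltn_trans yz xy.
exact: ltnn.
Qed.

Lemma mut_eq0 : (forall x, blocked x x) -> mut e = 0.
Proof.
move=> blk; apply/eqP; rewrite -leqn0; apply/bigmax_leqP => X /asboolP visX.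
rewrite leqn0 cards_eq0; apply/eqP/setP => x; rewrite inE; apply/negP => xX.
by have := blocked_notin visX (blk x) xX; rewrite xX.
Qed.

(** Blocking makes [f] injective on every total mutual-visibility set. *)
Lemma mut_leq k (f : T -> nat) :
  (forall x, f x < k) -> (forall x y, x != y -> f x = f y -> blocked x y) ->
  mut e <= k.
Proof.
move=> fk blk; apply/bigmax_leqP => X /asboolP visX.
pose g x := Ordinal (fk x).
suff /card_in_imset <- : {in X &, injective g}.
  by rewrite (leq_trans (max_card _)) ?card_ord.
move=> x y xX yX [fxy].
have [//|xy] := eqVneq x y.
by have := blocked_notin visX (blk x y xy fxy) xX; rewrite yX.
Qed.

Lemma mut_geq (s : seq T) (d : T -> T -> nat) : uniq s ->
  (forall v, d v v = 0) -> (forall v x y, e x y -> d x v <= (d y v).+1) ->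
  (forall v u, u != v ->
     exists w, [/\ e u w, d w v < d u v & (w == v) || (w \notin s)]) ->
  size s <= mut e.
Proof.
move=> us d0 lip step.
have <- : #|[set x in s]| = size s by rewrite cardsE; apply/card_uniqP.
apply: (@leq_bigmax_cond _ _ (fun X : {set T} => #|X|)).
apply/asboolP => u v _; apply: (@visible_descent _ v (d^~ v)) => [//|x y /lip //|w].
by case/step=> z [wz dz zs]; exists z; rewrite inE.
Qed.

(* Decision procedures quantifying over an explicit list of the vertices, since
   the enumeration of a finType does not compute. Conditions are expressed by
   filtering because vm_compute evaluates both arguments of && and ==>. *)

Definition blockedb (vs : seq T) x y :=
  has (fun u => has (fun v => [&& u != v, ~~ e u v &
      all (fun w => (w == x) || (w == y)) [seq w <- vs | e u w && e w v]])
    [seq v <- vs | e x v]) [seq u <- vs | e u x].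

Definition blocking_classes (vs : seq T) k (f : T -> nat) :=
  all (fun x => (f x < k) &&
    all (blockedb vs x) [seq y <- vs | (x != y) && (f x == f y)]) vs.

Definition visibility_certificate (vs s : seq T) (d : T -> T -> nat) :=
  uniq s && all (fun x => (d x x == 0) &&
    let nx := [seq y <- vs | e x y] in
    all (fun v => all (fun y => d x v <= (d y v).+1) nx &&
      ((x == v) || has (fun w => (d w v < d x v) && ((w == v) || (w \notin s))) nx))
    vs) vs.

Lemma mut_eq_size (vs s : seq T) (f : T -> nat) (d : T -> T -> nat) :
  (forall x, x \in vs) -> blocking_classes vs (size s) f ->
  visibility_certificate vs s d -> mut e = size s.
Proof.
move=> vsT /allP upper /andP[us /allP lower]; apply/eqP; rewrite eqn_leq.
apply/andP; split.
  apply: (@mut_leq _ f) => [x|x y xy fxy]; have /andP[// _ /allP] := upper x (vsT x).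
  move=> /(_ y); rewrite mem_filter xy fxy eqxx vsT => /(_ isT) /hasP[u].
  rewrite mem_filter => /andP[ux _] /hasP[v]; rewrite mem_filter => /andP[xv _].
  case/and3P=> uv nuv /allP common; exists u, v; split=> // w uw wv.
  by have := common w; rewrite mem_filter uw wv vsT => /(_ isT) /pred2P.
apply: (@mut_geq _ d) => // [v|v x y exy|v x xv].
- by have /andP[/eqP] := lower v (vsT v).
- have /andP[_ /allP/(_ v (vsT v))/andP[/allP/(_ y) + _]] := lower x (vsT x).
  by rewrite mem_filter exy vsT; apply.
have /andP[_ /allP/(_ v (vsT v))/andP[_]] := lower x (vsT x).
rewrite (negbTE xv) => /hasP[w]; rewrite mem_filter => /andP[xw _] /andP[? ?].
by exists w.
Qed.

End Visibility.

Fixpoint ord_seq n : seq 'I_n :=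
  if n is n'.+1 then ord0 :: [seq lift ord0 i | i <- ord_seq n'] else [::].

Lemma mem_ord_seq n (i : 'I_n) : i \in ord_seq n.
Proof.
elim: n i => [|n IHn] i; first by case: i.
rewrite inE; case: (unliftP ord0 i) => [j ->|-> //].
by rewrite map_f ?orbT.
Qed.

Definition torus_seq n m : seq ('I_n * 'I_m) :=
  [seq (i, j) | i <- ord_seq n, j <- ord_seq m].

Lemma mem_torus_seq n m (x : 'I_n * 'I_m) : x \in torus_seq n m.
Proof. by case: x => i j; rewrite allpairs_f ?mem_ord_seq. Qed.

(** With truncated subtraction, [i - j + (j - i)] is |i - j|; the minimum picks the shorter arc. *)
Definition cycle_dist n (i j : 'I_n) : nat :=
  minn (i - j + (j - i)) (n - (i - j + (j - i))).

Definition torus_dist n m (x y : 'I_n * 'I_m) : nat :=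
  cycle_dist x.1 y.1 + cycle_dist x.2 y.2.

Notation torus n m := (cartesian_product (@cycle_graph n) (@cycle_graph m)).

Lemma eq_ordS n (i j : 'I_n) :
  (j == ordS i) = (j == i.+1 :> nat) || (i.+1 == n) && (j == 0 :> nat).
Proof.
rewrite -val_eqE /=; have := ltn_ord i; rewrite leq_eqVlt => /predU1P[-> | lt_in].
  by rewrite modnn eqxx (ltn_eqF (ltn_ord j)).
by rewrite modn_small // (ltn_eqF lt_in) orbF.
Qed.

Lemma torus_blocked n m : 4 < n -> 1 < m ->
  forall x : 'I_n * 'I_m, blocked (torus n m) x x.
Proof.
move=> n_gt4 m_gt1 [i j].
(* Seeing [i] as the successor of its predecessor describes both neighbours by linear constraints
   without modulus, fit for [lia]. *)
have := eqxx (ordS i); have := eqxx i; rewrite -{2}[i]ord_predK !eq_ordS.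
move: (ord_pred i) (ordS i) => a b iE bE.
(* For n = 3 these two are adjacent, and for n = 4 they share a second neighbour, with first
   coordinate i + 2. *)
exists (a, j), (b, j).
rewrite /cartesian_product /cycle_graph !eq_ordS !xpair_eqE -!val_eqE /= !eqxx.
case: i j a b iE bE => [i lti] [j ltj] [a lta] [b ltb] /= iE bE.
split; [lia..|]; case=> [[k ltk] [l ltl]] /=.
rewrite !eq_ordS -!val_eqE /= => uw wv; left.
by congr (_, _); apply: val_inj => /=; lia.
Qed.

(** Distinct vertices of a class differ in both coordinates, so they are opposite corners of a
    product of two edges. *)
Lemma mut_torus33 : mut (torus 3 3) = 3.
Proof.
pose s := [seq (ord0 : 'I_3, j) | j <- ord_seq 3].
apply: (@mut_eq_size _ _ (torus_seq 3 3) s (fun x => (x.1 + x.2) %% 3)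
  (@torus_dist 3 3)) => [x||]; [exact: mem_torus_seq | by vm_compute..].
Qed.

(** Distinct vertices of a class are antipodal in a copy of C_4 or opposite corners of a product of
    two edges. *)
Lemma mut_torus43 : mut (torus 4 3) = 3.
Proof.
pose s := [seq (ord0 : 'I_4, j) | j <- ord_seq 3].
apply: (@mut_eq_size _ _ (torus_seq 4 3) s (fun x => (odd x.1 + x.2) %% 3)
  (@torus_dist 4 3)) => [x||]; [exact: mem_torus_seq | by vm_compute..].
Qed.

(* C_4 x C_4 is the hypercube Q_4: two pairs of antipodal vertices. *)
Lemma mut_torus44 : mut (torus 4 4) = 4.
Proof.
pose o k : 'I_4 := nth ord0 (ord_seq 4) k.
pose s := [:: (o 0, o 0); (o 0, o 1); (o 2, o 2); (o 2, o 3)].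
(* Halving the first coordinate splits Q_4 into two 3-cubes, and parity splits each into two sets of
   four vertices pairwise at distance 2. *)
apply: (@mut_eq_size _ _ (torus_seq 4 4) s
  (fun x => (x.1)./2.*2 + odd (x.1 + x.2)) (@torus_dist 4 4)) => [x||].
- exact: mem_torus_seq.
- by vm_compute.
- by vm_compute.
Qed.

Theorem theorem4p7 (n m : nat) (m_ge3 : 3 <= m) (n_ge_m : m <= n) :
  mut (cartesian_product (@cycle_graph n) (@cycle_graph m)) =
    if (n, m) \in [:: (3, 3); (4, 3)] then 3
    else if (n, m) == (4, 4) then 4
    else 0.
Proof.
have [n_gt4 | n_le4] := ltnP 4 n.
  rewrite mut_eq0; last exact: torus_blocked n_gt4 (ltnW m_ge3).
  by rewrite !inE !xpair_eqE (gtn_eqF n_gt4) (gtn_eqF (ltnW n_gt4)).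
have [[-> ->]|[[-> ->]|[-> ->]]] :
  (n = 3 /\ m = 3) \/ (n = 4 /\ m = 3) \/ (n = 4 /\ m = 4) by lia.
- exact: mut_torus33.
- exact: mut_torus43.
- exact: mut_torus44.
Qed.
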